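(* Let $d\ge1$ and let $v_1,v_2,\dots$ be a sequence of independent random variables, each uniformly distributed on the cube $[0,1]^d$. Then, with probability $1$, the sequence $\{v_n\}_{n\ge1}$ is $\gamma$-uniformly distributed for all $\gamma\in(0,\frac12)$.
   Context: For $\gamma\in(0,\frac12]$, a sequence of points $\{v_n\}_{n\ge1}$ in $[0,1]^d$ is $\gamma$-uniformly distributed if for every $\epsilon>0$ there is a constant $C_\epsilon$ (which may depend on the sequence) such that for every $k\in\mathbb{Z}^d\setminus\{0\}$ and every integer $N\ge 1$, $$\left|\frac1N\sum_{n=1}^N e^{2\pi i k\cdot v_n}\right|\le C_\epsilon|k|^\epsilon N^{-\gamma}.$$ *)

(* Defs.v *)
From HB Require Import structures.
From mathcomp Require Import all_boot all_order all_algebra finmap.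
From mathcomp Require Import all_classical all_reals all_analysis.
From mathcomp Require Import complex.

Set Implicit Arguments.
Unset Strict Implicit.
Unset Printing Implicit Defensive.

Import Order.TTheory GRing.Theory Num.Theory.
Import numFieldNormedType.Exports.

Local Open Scope classical_set_scope.
Local Open Scope ring_scope.

(** Points of R^d are [d.-tuple R], which the library equips with the product
    (i.e. Borel) sigma-algebra; frequencies in Z^d are row vectors ['rV[int]_d]. *)

Definition unit_cube (R : realType) (d : nat) : set (d.-tuple R) :=
  [set x | forall i : 'I_d, 0 <= tnth x i <= 1].
Arguments unit_cube : clear implicits.

Definition dotprod (R : realType) (d : nat) (k : 'rV[int]_d) (x : d.-tuple R)
    : R :=
  \sum_(i < d) (k ord0 i)%:~R * tnth x i.

(** The Euclidean norm: the norm the library puts on row vectors is the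
    supremum norm. *)
Definition enorm (R : realType) (d : nat) (k : 'rV[int]_d) : R :=
  Num.sqrt (\sum_(i < d) (k ord0 i)%:~R ^+ 2).
Arguments enorm : clear implicits.

(** [expi t] is $e^{it}$. *)
Definition expi (R : realType) (t : R) : R[i] := Complex (cos t) (sin t).

Definition exp_mean (R : realType) (d : nat) (v : nat -> d.-tuple R)
    (k : 'rV[int]_d) (N : nat) : R[i] :=
  N%:R^-1 * \sum_(n < N) expi (2 * pi * dotprod k (v n)).

(** Sequences are indexed from 0, so that the first [N] terms are
    [v 0, ..., v N.-1]. [normc] is the real-valued modulus on [R[i]] and
    [`^] the real power. *)
Definition gamma_uniformly_distributed (R : realType) (d : nat) (gamma : R)
    (v : nat -> d.-tuple R) : Prop :=
  (forall n, unit_cube R d (v n)) /\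
  forall eps : R, 0 < eps ->
    exists C : R, forall (k : 'rV[int]_d) (N : nat), k != 0 -> (0 < N)%N ->
      ComplexField.Normc.normc (exp_mean v k N)
        <= C * (enorm R d k `^ eps) * (N%:R `^ (- gamma)).

(** The d-dimensional Lebesgue measure of a measurable set, as the d-fold
    product of the one-dimensional one: the clause for [n.+1] is what the
    product measure of [lebesgue_measure] and [lebesgue_measure_tuple n]
    unfolds to. *)
Fixpoint lebesgue_measure_tuple (R : realType) (n : nat)
    : set (n.-tuple R) -> \bar R :=
  match n return set (n.-tuple R) -> \bar R with
  | 0%N => fun A => \d_([tuple] : 0.-tuple R) A
  | m.+1 => fun A =>
      (\int[@lebesgue_measure R]_x
         lebesgue_measure_tuple [set t : m.-tuple R | A [tuple of x :: t]])%E
  end.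

(** The cube has volume 1, so no normalisation is needed. *)
Definition uniform_on_cube (disp : measure_display) (T : measurableType disp)
    (R : realType) (P : probability T R) (d : nat)
    (X : {RV P >-> d.-tuple R}) : Prop :=
  forall A : set (d.-tuple R), measurable A ->
    distribution P X A = lebesgue_measure_tuple (A `&` unit_cube R d).

Definition mutually_independent (disp : measure_display)
    (T : measurableType disp) (R : realType) (P : probability T R)
    (dE : measure_display) (E : measurableType dE)
    (X : nat -> {RV P >-> E}) : Prop :=
  forall (J : {fset nat}) (A : nat -> set E),
    (forall j, j \in J -> measurable (A j)) ->
    P (\bigcap_(j in [set` J]) (X j @^-1` A j))
      = (\prod_(j <- J) P (X j @^-1` A j))%E.

(* Main.v *)
Require Import Defs.
From HB Require Import structures.
From mathcomp Require Import all_boot all_order all_algebra finmap.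
From mathcomp Require Import all_classical all_reals all_analysis.
From mathcomp Require Import measurable_realfun complex.
From mathcomp Require Import ring lra zify.

Import Order.TTheory GRing.Theory Num.Theory.
Import numFieldNormedType.Exports.

Local Open Scope classical_set_scope.
Local Open Scope ring_scope.

(** The normalised exponential sum
    [N^{-1/2} \sum_(n < N) cos (2 pi k . v_n + phi)], [k != 0], has exponential
    moments bounded independently of [k], [N] and the phase [phi]. Indeed
    [exp y <= 1 + y + 2 y^2] for [y <= 1], so the exponential of the sum is at
    most the product over [n < N] of [1 + 2 / N + N^{-1/2} cos (...)]
    ([expR_le_majorant]). By independence the mean of the product is the product
    of the means ([independent_prod]). Each mean is [1 + 2 / N], because a cosine
    with [k != 0] averages to [0] over the cube ([uniform_wave_mean]). The whole
    is thus at most [(1 + 2 / N)^N <= e^2] ([exp_majorant_mean]).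

    The frequencies with coordinates at most [L], the lengths [N <= L] and the
    four phases [0, pi / 2, pi, 3 pi / 2] number polynomially many in [L], so the
    sum of all these majorants has mean polynomial in [L]. A convergent series of
    expectations then shows that almost surely these sums are bounded by a
    polynomial in [L] for all [L] simultaneously ([ae_bounded_growth],
    [ae_exp_majorant_polynomial]). Taking logarithms with [L = N |k|^2], almost
    surely all exponential sums of length [N] are
    [O (sqrt N (1 + log N + log |k|))], which gives every exponent
    [gamma < 1 / 2] and every [eps > 0] at once
    ([gamma_uniformly_distributed_of_majorant]).

    The vanishing of the mean of a cosine rests on a symmetry: rotating one
    coordinate on which [k] is nonzero by half a period changes the sign of the
    cosine and preserves the uniform distribution. It is enough to check the
    invariance on boxes, whose measure is a product of lengths. *)

(** * Boxes and rotations of the unit interval *)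

Definition box {R : realType} {d : nat} (A : 'I_d -> set R) : set (d.-tuple R) :=
  [set x | forall i, A i (tnth x i)].

Lemma box_setI (R : realType) (d : nat) (A B : 'I_d -> set R) :
  box A `&` box B = box (fun i => A i `&` B i).
Proof.
by apply/seteqP; split=> [x [xA xB] i|x xAB]; [split|split=> i; case: (xAB i)].
Qed.

Lemma unit_cube_box (R : realType) (d : nat) :
  unit_cube R d = box (fun=> `[0, 1]%classic).
Proof. by apply/seteqP; split=> x xI i; have := xI i; rewrite /= in_itv. Qed.

Lemma measurable_box (R : realType) (d : nat) (A : 'I_d -> set R) :
  (forall i, measurable (A i)) -> measurable (box A).
Proof.
move=> mA.
have -> : box A = \bigcap_(i in [set: 'I_d]) ((fun x => tnth x i) @^-1` A i).
  by apply/seteqP; split=> [x xA i _|x xA i]; exact: xA.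
apply: fin_bigcap_measurable => [|i _]; first exact: finite_finset.
by rewrite -[X in measurable X]setTI; exact: measurable_tnth.
Qed.

Lemma lebesgue_measure_tuple0 (R : realType) (d : nat) :
  lebesgue_measure_tuple (set0 : set (d.-tuple R)) = 0%E.
Proof.
elim: d => [|d IHd] /=; first by rewrite diracE in_set0.
by rewrite integral0_eq.
Qed.

(** Slices of a box are either empty or a fixed smaller box, so the recursive
    integral is that of a multiple of an indicator. *)
Lemma lebesgue_measure_tuple_box (R : realType) (d : nat) (A : 'I_d -> set R) :
  (forall i, measurable (A i)) ->
  lebesgue_measure_tuple (box A) = (\prod_(i < d) @lebesgue_measure R (A i))%E.
Proof.
elim: d A => [|d IHd] A mA /=.
  by rewrite big_ord0 diracE mem_set// => -[].
rewrite big_ord_recl -IHd; last by move=> i; exact: mA.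
have slice (x : R) : lebesgue_measure_tuple
    [set t : d.-tuple R | box A [tuple of x :: t]] =
    (lebesgue_measure_tuple (box (fun i => A (lift ord0 i))) *
     (\1_(A ord0) x)%:E)%E.
  rewrite indicE; case: (boolP (x \in A ord0)) => xA.
    rewrite mule1; congr lebesgue_measure_tuple; apply/seteqP; split=> t /= tA.
      by move=> i; have := tA (lift ord0 i); rewrite tnthS.
    move=> i; case: (unliftP ord0 i) => [j|] ->; first by rewrite tnthS; exact: tA.
    by rewrite tnth0; exact: set_mem.
  rewrite mule0 -[RHS](lebesgue_measure_tuple0 R d); congr lebesgue_measure_tuple.
  apply/seteqP; split=> t //= tA; move: xA; rewrite notin_setE; apply.
  exact: tA ord0.
under eq_integral do rewrite slice.
rewrite ge0_integralZl//=.
- by rewrite integral_indic ?setIT 1?muleC//; exact: mA.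
- by apply/measurable_EFinP; apply: measurable_indic; exact: mA.
- rewrite IHd; last by move=> i; exact: mA.
  by apply: prode_ge0 => i _; exact: measure_ge0.
Qed.

Lemma lebesgue_measure_translation (R : realType) (c : R) (A : set R) :
  measurable A ->
  @lebesgue_measure R ((fun x => x + c) @^-1` A) = lebesgue_measure A.
Proof.
have mc : measurable_fun [set: measurableTypeR R]
    ((fun x => x + c) : _ -> measurableTypeR R).
  exact: measurable_funD.
pose f : {mfun measurableTypeR R >-> measurableTypeR R} :=
  HB.pack ((fun x => x + c) : _ -> measurableTypeR R)
    (isMeasurableFun.Build _ _ _ _ _ mc).
move=> mA; suff : pushforward (@lebesgue_measure R) f A = lebesgue_measure A by [].
apply/esym/lebesgue_measure_unique => //=.
move=> _ [[a b]] _ <-.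
have -> : pushforward (@lebesgue_measure R) f `]a, b]%classic =
    lebesgue_measure `]a - c, b - c]%classic.
  rewrite /pushforward; congr (lebesgue_measure _); apply/seteqP.
  by split=> x /=; rewrite !in_itv/= ltrBlDr lerBrDr.
rewrite !lebesgue_measure_itv/= !lte_fin ltrD2r; case: ifP => // _.
by rewrite -!EFinD; congr (_%:E); ring.
Qed.

(** The rotation by [theta] of the circle obtained by gluing the endpoints of
    the unit interval. *)
Definition rotate {R : realType} (theta x : R) : R :=
  if x < 1 - theta then x + theta else x + theta - 1.

Lemma measurable_rotate (R : realType) (theta : R) :
  measurable_fun [set: R] (rotate theta).
Proof.
rewrite /rotate; apply: measurable_fun_ifT.
- exact: measurable_fun_ltr.
- exact: measurable_funD.
- by apply: measurable_funB => //; exact: measurable_funD.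
Qed.

Lemma lebesgue_measure_setI_itvcc (R : realType) (A : set R) : measurable A ->
  lebesgue_measure (A `&` `[0, 1]) = lebesgue_measure (A `&` `[0, 1[) :> \bar R.
Proof.
move=> mA.
(* the endpoint [1], glued to [0], is negligible *)
have -> : A `&` `[0, 1] = (A `&` `[0, 1[) `|` (A `&` [set 1 : R]).
  rewrite -setIUr; congr (_ `&` _); apply/seteqP; split=> x /=; rewrite !in_itv/=.
    move=> /andP[x0]; rewrite le_eqVlt => /orP[/eqP|x1]; [by right|left].
    by rewrite x0.
  by move=> [/andP[-> /ltW]|->] //; rewrite ler01 lexx.
have mA1 : measurable (A `&` [set 1 : R]) by exact: measurableI.
have mA2 : measurable (A `&` `[0, 1[) by exact: measurableI.
rewrite measureU0//.
by apply: (subset_measure0 _ _ _ (lebesgue_measure_set1 (1 : R))).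
Qed.

(** The rotation exchanges the two subintervals cut at [1 - theta], moving each
    by a translation. *)
Lemma lebesgue_measure_rotate (R : realType) (theta : R) (A : set R) :
  0 <= theta < 1 -> measurable A ->
  lebesgue_measure (rotate theta @^-1` A `&` `[0, 1]) =
  lebesgue_measure (A `&` `[0, 1]) :> \bar R.
Proof.
move=> /andP[theta0 theta1] mA.
have mrA : measurable (rotate theta @^-1` A).
  by rewrite -[X in measurable X]setTI; exact: measurable_rotate.
rewrite !lebesgue_measure_setI_itvcc//.
have -> : rotate theta @^-1` A `&` `[0, 1[ =
    ((fun x => x + theta) @^-1` (A `&` `[theta, 1[)) `|`
    ((fun x => x + (theta - 1)) @^-1` (A `&` `[0, theta[)).
  rewrite /rotate; apply/seteqP; split=> x /=; rewrite !in_itv/=.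
    case: ltP => xt [Ax /andP[x0 x1]].
      by left; split=> //; apply/andP; split; lra.
    by right; rewrite addrA; split=> //; apply/andP; split; lra.
  move=> [|]; rewrite ?addrA => -[Ax /andP[x0 x1]].
    by rewrite ifT; last lra; split=> //; apply/andP; split; lra.
  by rewrite ifF; last lra; split=> //; apply/andP; split; lra.
have mtr c (B : set R) : measurable B -> measurable ((fun x => x + c) @^-1` B).
  move=> mB; rewrite -[X in measurable X]setTI.
  have mc : measurable_fun [set: R] (fun x => x + c) by exact: measurable_funD.
  exact: mc.
have mA1 : measurable (A `&` `[theta, 1[) by exact: measurableI.
have mA2 : measurable (A `&` `[0, theta[) by exact: measurableI.
rewrite measureU; [|exact: mtr|exact: mtr|]; last first.
  apply/seteqP; split=> x //= [[_ +] [_]]; rewrite !in_itv/= => /andP[? ?] /andP[? ?].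
  lra.
transitivity (lebesgue_measure (A `&` `[theta, 1%R[) +
    lebesgue_measure (A `&` `[0%R, theta[))%E.
  by congr (_ + _)%E; exact: lebesgue_measure_translation.
rewrite -measureU//; last first.
  apply/seteqP; split=> x //= [[_ +] [_]]; rewrite !in_itv/= => /andP[? ?] /andP[? ?].
  lra.
congr (lebesgue_measure _); rewrite -setIUr; congr (_ `&` _).
apply/seteqP; split=> x /=; rewrite !in_itv/=.
  by move=> [|] /andP[? ?]; apply/andP; split; lra.
move=> /andP[x0 x1]; case: (leP theta x) => tx; [left|right].
  by rewrite x1.
by rewrite x0.
Qed.

(** * Symmetries of the uniform distribution on the cube *)

(** Boxes are stable under intersection and, as they include the preimages of
    measurable sets by the coordinates, generate the product sigma-algebra. *)
Lemma tuple_measure_unique (R : realType) (d : nat)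
    (m1 m2 : {measure set (d.-tuple R) -> \bar R}) :
  (m1 setT < +oo)%E ->
  (forall A : 'I_d -> set R, (forall i, measurable (A i)) ->
    m1 (box A) = m2 (box A)) ->
  forall B, measurable B -> m1 B = m2 B.
Proof.
move=> m1T m12 B mB.
pose G := [set box A | A in [set A : 'I_d -> set R | forall i, measurable (A i)]].
apply: (measure_unique G (fun=> setT)) => //.
- apply/seteqP; split.
    apply: smallest_sub; first exact: smallest_sigma_algebra.
    move=> C; rewrite -bigcup_seq/= => -[i _ [A mA <-]].
    apply: sub_sigma_algebra; exists (fun j => if j == i then A else setT).
      by move=> j /=; case: ifP.
    rewrite setTI; apply/seteqP; split=> x /=; first by move=> /(_ i); rewrite eqxx.
    by move=> xA j; case: eqVneq => [->|].
  apply: smallest_sub; first exact: sigma_algebra_measurable.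
  by move=> _ [A mA <-]; exact: measurable_box.
- move=> _ _ [A mA <-] [A' mA' <-]; rewrite box_setI.
  by exists (fun i => A i `&` A' i) => // i; exact: measurableI.
- by move=> _; exists (fun=> setT) => //; apply/seteqP; split.
- by apply/seteqP; split=> // x _; exists 0%N.
- by move=> _ [A mA <-]; exact: m12.
Qed.

Definition rotate_coord {R : realType} {d : nat} (i : 'I_d) (theta : R)
    (x : d.-tuple R) : d.-tuple R :=
  [tuple if j == i then rotate theta (tnth x j) else tnth x j | j < d].

Lemma measurable_rotate_coord (R : realType) (d : nat) (i : 'I_d) (theta : R) :
  measurable_fun [set: d.-tuple R] (rotate_coord i theta).
Proof.
apply/measurable_fun_tnthP => j.
rewrite (_ : _ \o _ = fun x : d.-tuple R =>
    if j == i then rotate theta (tnth x j) else tnth x j); last first.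
  by apply/funext => x /=; rewrite tnth_mktuple.
case: (j == i); last exact: measurable_tnth.
by apply: measurableT_comp; [exact: measurable_rotate|exact: measurable_tnth].
Qed.

Section uniform.
Context {R : realType} {disp : measure_display} {T : measurableType disp}
  {P : probability T R} {d : nat} {X : {RV P >-> d.-tuple R}}
  (X_unif : uniform_on_cube X).

Lemma uniform_box (A : 'I_d -> set R) : (forall i, measurable (A i)) ->
  P (X @^-1` box A) = (\prod_(i < d) @lebesgue_measure R (A i `&` `[0%R, 1%R]))%E.
Proof.
move=> mA; have /= := X_unif _ (measurable_box _ _ _ mA).
rewrite /distribution/pushforward => ->.
rewrite unit_cube_box box_setI lebesgue_measure_tuple_box// => i.
exact: measurableI.
Qed.

Lemma uniform_in_unit_cube : {ae P, forall omega, unit_cube R d (X omega)}.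
Proof.
have mcube : measurable (unit_cube R d).
  by rewrite unit_cube_box; exact: measurable_box.
exists (X @^-1` ~` unit_cube R d); split => //.
- by rewrite -[X in measurable X]setTI; apply: measurable_funP => //; exact: measurableC.
- have /= := X_unif _ (measurableC mcube).
  by rewrite /distribution/pushforward => ->; rewrite setICl lebesgue_measure_tuple0.
Qed.

(** Rotating a coordinate keeps the volume of boxes, hence the law of [X]. *)
Lemma uniform_rotate (i : 'I_d) (theta : R) (f : d.-tuple R -> \bar R) :
  0 <= theta < 1 -> measurable_fun setT f -> (forall x, 0 <= f x)%E ->
  (\int[P]_omega f (X omega) = \int[P]_omega f (rotate_coord i theta (X omega)))%E.
Proof.
move=> theta01 mf f0.
have mrX : measurable_fun setT (rotate_coord i theta \o X).
  by apply: measurableT_comp => //; exact: measurable_rotate_coord.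
pose Y : {RV P >-> d.-tuple R} :=
  HB.pack (rotate_coord i theta \o X) (isMeasurableFun.Build _ _ _ _ _ mrX).
rewrite -[LHS](ge0_integral_pushforward (measurable_funPT X) P measurableT)//.
rewrite -[RHS](ge0_integral_pushforward (measurable_funPT Y) P measurableT)//.
apply: eq_measure_integral => B mB _.
apply: tuple_measure_unique => // [|A mA].
  by rewrite /= /pushforward preimage_setT probability_setT ltry.
rewrite [LHS]uniform_box//.
transitivity
    (P (X @^-1` box (fun j => if j == i then rotate theta @^-1` A j else A j)));
    last first.
  congr (P _); apply/seteqP; split=> omega /= XA j; have := XA j.
    by rewrite tnth_mktuple; case: ifP.
  by rewrite tnth_mktuple; case: ifP.
rewrite uniform_box; last first.
  move=> j; case: ifP => // _; rewrite -[X in measurable X]setTI.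
  exact: measurable_rotate.
apply: eq_bigr => j _; case: ifP => // _.
by apply/esym; exact: lebesgue_measure_rotate.
Qed.

End uniform.

(** * Cosine waves average to zero *)

Lemma cosD2pi_int (R : realType) (m : int) (x : R) :
  cos (x + 2 * pi * m%:~R) = cos x.
Proof.
have nat_case (n : nat) y : cos (y + 2 * pi * n%:R) = cos y :> R.
  rewrite -[RHS](periodicn (@cosD2pi R) n); congr cos.
  by rewrite -mulrnA -[in RHS]mulr_natr natrM; ring.
case: m => n; first exact: nat_case.
rewrite NegzE -[LHS](nat_case n.+1); congr cos.
by rewrite mulrNz pmulrn; ring.
Qed.

Definition wave {R : realType} {d : nat} (k : 'rV[int]_d) (phi : R)
    (x : d.-tuple R) : R := cos (2 * pi * dotprod k x + phi).

Lemma measurable_wave (R : realType) (d : nat) (k : 'rV[int]_d) (phi : R) :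
  measurable_fun [set: d.-tuple R] (wave k phi).
Proof.
apply: measurableT_comp; first by apply: continuous_measurable_fun; exact: continuous_cos.
apply: measurable_funD => //; apply: measurable_funM => //.
apply: measurable_sum => i; apply: measurable_funM => //.
exact: measurable_tnth.
Qed.

(** Moving the [i]-th coordinate by [theta] modulo [1] changes the phase by
    [2 pi k_i theta] modulo [2 pi], which is [pi] or [- pi] for this [theta]. *)
Lemma wave_rotate_coord (R : realType) (d : nat) (k : 'rV[int]_d) (phi : R)
    (i : 'I_d) (x : d.-tuple R) : k ord0 i != 0 ->
  wave k phi (rotate_coord i (2 * `|(k ord0 i)%:~R|)^-1 x) = - wave k phi x.
Proof.
move=> ki0.
set a : R := (k ord0 i)%:~R; set theta : R := (2 * `|a|)^-1.
have a0 : a != 0 by rewrite intr_eq0.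
have [m dotE] : exists m : int,
    dotprod k (rotate_coord i theta x) = dotprod k x + a * theta + m%:~R.
  exists (if tnth x i < 1 - theta then 0 else - k ord0 i).
  rewrite /dotprod (bigD1 i)//= [in RHS](bigD1 i)//= tnth_mktuple eqxx.
  rewrite (eq_bigr (fun j => (k ord0 j)%:~R * tnth x j)); last first.
    by move=> j /negbTE ji; rewrite tnth_mktuple ji.
  by rewrite /rotate -/a; case: ifP => _; rewrite ?mulrNz -/a /=; ring.
rewrite /wave dotE.
have -> : 2 * pi * (dotprod k x + a * theta + m%:~R) + phi =
    2 * pi * dotprod k x + phi + pi * (a / `|a|) + 2 * pi * m%:~R.
  by rewrite /theta; field; rewrite normr_eq0.
rewrite cosD2pi_int.
have [a_gt0|a_le0] := ltP 0 a.
  by rewrite gtr0_norm// divff// mulr1 cosDpi.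
rewrite ler0_norm// invrN mulrN divff// mulrN1.
by rewrite -[RHS](cosDpi) -(cosD2pi_int _ 1); congr cos; rewrite mulr1; ring.
Qed.

Section uniform_wave.
Context {R : realType} {disp : measure_display} {T : measurableType disp}
  {P : probability T R} {d : nat} {X : {RV P >-> d.-tuple R}}
  (X_unif : uniform_on_cube X).

(** By symmetry [wave] and [- wave] have the same mean. The constant [c] keeps
    the integrand nonnegative, so that integrals add without integrability
    conditions. *)
Lemma uniform_wave_mean (k : 'rV[int]_d) (phi a c : R) : k != 0 -> `|a| <= c ->
  (\int[P]_omega (c + a * wave k phi (X omega))%:E = c%:E)%E.
Proof.
move=> k0 ac.
have /existsP[i ki0] : [exists i, k ord0 i != 0].
  apply: contra_neqT k0; rewrite negb_exists => /forallP k0.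
  by apply/rowP => i; rewrite mxE; apply/eqP; have := k0 i; rewrite negbK.
have wave_ge0 b y : `|b| <= c -> 0 <= c + b * wave k phi y.
  move=> bc; have : `|b * wave k phi y| <= c.
    by rewrite normrM (le_trans _ bc)// ler_piMr//; exact: cos_max.
  by rewrite ler_norml => /andP[+ _]; rewrite -subr_ge0 opprK addrC.
have mwave b : measurable_fun setT (fun y : d.-tuple R => (c + b * wave k phi y)%:E).
  apply/measurable_EFinP; apply: measurable_funD => //.
  by apply: measurable_funM => //; exact: measurable_wave.
have mX b : measurable_fun setT (fun omega => (c + b * wave k phi (X omega))%:E).
  exact: (measurableT_comp (mwave b)).
pose theta : R := (2 * `|(k ord0 i)%:~R|)^-1.
have norm_ge1 : 1 <= `|(k ord0 i)%:~R| :> R.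
  by rewrite -intr_norm ler1z -gtz0_ge1 normr_gt0.
have theta01 : 0 <= theta < 1.
  rewrite /theta invr_ge0 mulr_ge0//= invf_lt1; lra.
have /= flip := uniform_rotate X_unif i theta _ theta01 (mwave a).
have {flip} : (\int[P]_omega (c + a * wave k phi (X omega))%:E =
    \int[P]_omega (c + (- a) * wave k phi (X omega))%:E)%E.
  rewrite flip; last by move=> y; rewrite lee_fin wave_ge0.
  by apply: eq_integral => omega _; rewrite wave_rotate_coord// mulrN mulNr.
move=> flip.
have : (\int[P]_omega (c + a * wave k phi (X omega))%:E +
    \int[P]_omega (c + a * wave k phi (X omega))%:E = (c + c)%:E)%E.
  rewrite {2}flip -ge0_integralD//.
  - transitivity (\int[P]_omega (cst (c + c)%:E omega))%E.
      by apply: eq_integral => omega _ /=; rewrite -EFinD; congr (_%:E); ring.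
    by rewrite integral_cst//= probability_setT mule1.
  - by move=> omega _; rewrite lee_fin wave_ge0.
  - by move=> omega _; rewrite lee_fin wave_ge0 ?normrN.
case: (integral _ _ _) => // r [rr]; congr (_%:E); lra.
Qed.

End uniform_wave.

(** * Expectation of a product of independent variables *)

Section weighted_integral.
Local Open Scope ereal_scope.
Context {R : realType} {dT dE : measure_display} {T : measurableType dT}
  {E : measurableType dE} (mu : {measure set T -> \bar R})
  (X : {mfun T >-> E}).
Import HBNNSimple.

Lemma measurable_preimage_mfun (A : set E) : measurable A ->
  measurable (X @^-1` A).
Proof. by move=> mA; rewrite -[Y in measurable Y]setTI; exact: measurable_funP. Qed.

(** The coefficients are written [`|r|] to keep every term nonnegative even for
    values [r] outside of the range. *)
Lemma nnsfun_sum_indic (h : {nnsfun E >-> R}) (y : E) :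
  h y = (\sum_(r <- fset_set (range h)) `|r| * \1_(h @^-1` [set r]) y)%R.
Proof.
rewrite fimfunE fsbig_finite//=; apply: eq_bigr => r _.
rewrite !indicE; case: (boolP (y \in _)) => yr; last by rewrite !mulr0.
by rewrite !mulr1 ger0_norm//; move: yr; rewrite inE => /= <-.
Qed.

Lemma ge0_integral_mul_nnsfun (G : T -> R) (h : {nnsfun E >-> R}) :
  measurable_fun setT G -> (forall t, 0 <= G t)%R ->
  \int[mu]_t (G t * h (X t))%:E =
  \sum_(r <- fset_set (range h))
    `|r|%:E * \int[mu]_t (G t * \1_(h @^-1` [set r]) (X t))%:E.
Proof.
move=> mG G0.
have mGI r : measurable_fun setT (fun t => (G t * \1_(h @^-1` [set r]) (X t))%:E).
  apply/measurable_EFinP; apply: measurable_funM => //.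
  by apply: measurableT_comp => //; exact: measurable_indic.
have GI0 r t : 0 <= (G t * \1_(h @^-1` [set r]) (X t))%:E.
  by rewrite lee_fin mulr_ge0.
under eq_bigr => r _ do rewrite -ge0_integralZl//.
rewrite -ge0_integral_sum//.
- apply: eq_integral => t _; rewrite [in LHS]nnsfun_sum_indic mulr_sumr -sumEFin.
  by apply: eq_bigr => r _; rewrite -EFinM; congr (_%:E); ring.
- by move=> r; exact: measurable_funeM.
- by move=> r t _; rewrite mule_ge0.
Qed.

(** Both sides are additive and continuous along increasing sequences in [f], so
    the identity extends from indicators to simple functions and to their
    monotone limits. This is how independence passes from events to
    functions. *)
Lemma ge0_integral_weight (G : T -> R) (K : \bar R) :
  measurable_fun setT G -> (forall t, 0 <= G t)%R -> K \is a fin_num ->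
  (forall A, measurable A ->
    \int[mu]_t (G t * \1_A (X t))%:E = K * mu (X @^-1` A)) ->
  forall f : E -> R, measurable_fun setT f -> (forall y, 0 <= f y)%R ->
    \int[mu]_t (G t * f (X t))%:E = K * \int[mu]_t (f (X t))%:E.
Proof.
move=> mG G0 Kfin GK f mf f0.
have mEf : measurable_fun setT (EFin \o f) by exact/measurable_EFinP.
pose h := nnsfun_approx measurableT mEf.
have GKh n : \int[mu]_t (G t * h n (X t))%:E = K * \int[mu]_t (h n (X t))%:E.
  have := ge0_integral_mul_nnsfun (cst 1%R) (h n) (measurable_cst _) (fun=> ler01).
  under eq_integral do rewrite mul1r.
  move=> ->; rewrite ge0_integral_mul_nnsfun// ge0_sume_distrr; last first.
    move=> r _; rewrite mule_ge0// integral_ge0// => t _.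
    by rewrite lee_fin mul1r.
  apply: eq_bigr => r _; rewrite GK//.
  under eq_integral do rewrite mul1r.
  rewrite muleCA; congr (_ * (_ * _)).
  rewrite [RHS](_ : _ = \int[mu]_t (\1_(X @^-1` (h n @^-1` [set r])) t)%:E)//.
  by rewrite integral_indic ?setIT//; exact: measurable_preimage_mfun.
have cvg_int (W : T -> R) : measurable_fun setT W -> (forall t, 0 <= W t)%R ->
    \int[mu]_t (W t * h n (X t))%:E @[n --> \oo] --> \int[mu]_t (W t * f (X t))%:E.
  move=> mW W0; rewrite (_ : \int[mu]_t (W t * f (X t))%:E =
      \int[mu]_t (limn (fun n => (W t * h n (X t))%:E))).
    apply: cvg_monotone_convergence => //.
    - move=> n; apply/measurable_EFinP; apply: measurable_funM => //.
      exact: measurableT_comp.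
    - by move=> n t _; rewrite lee_fin mulr_ge0.
    - move=> t _ m n mn; rewrite lee_fin ler_wpM2l//.
      exact/lefP/nd_nnsfun_approx.
  apply: eq_integral => t _; apply/esym/cvg_lim => //.
  under eq_fun do rewrite EFinM.
  rewrite EFinM; apply: cvgeZl => //.
  by apply: (cvg_nnsfun_approx measurableT mEf) => // y _; rewrite lee_fin.
apply: (cvg_unique _ (cvg_int G mG G0)) => //.
rewrite (funext GKh); apply: cvgeZl => //.
have := cvg_int (cst 1%R) (measurable_cst _) (fun=> ler01).
under eq_fun do under eq_integral do rewrite mul1r.
by under eq_integral do rewrite mul1r.
Qed.

End weighted_integral.

Section independence.
Local Open Scope ereal_scope.
Context {R : realType} {disp dE : measure_display} {T : measurableType disp}
  {E : measurableType dE} {P : probability T R} {v : nat -> {RV P >-> E}}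
  (v_indep : mutually_independent v).

Lemma independent_prod_indic (A : nat -> set E) (N : nat) :
  (forall n, measurable (A n)) ->
  \int[P]_t (\prod_(n < N) \1_(A n) (v n t))%:E =
  \prod_(n < N) P (v n @^-1` A n).
Proof.
move=> mA; pose J := [fset n in iota 0 N]%fset.
have JE n : (n \in J) = (n < N)%N by rewrite inE mem_iota.
have -> : \prod_(n < N) P (v n @^-1` A n) = \prod_(n <- J) P (v n @^-1` A n).
  rewrite -(big_mkord xpredT (fun n => P (v n @^-1` A n))) /index_iota subn0.
  apply: perm_big; apply: uniq_perm; rewrite ?iota_uniq ?fset_uniq// => n.
  by rewrite JE mem_iota.
rewrite -v_indep => [|n _]; last exact: mA.
rewrite -[RHS](_ : \int[P]_t (\1_(\bigcap_(n in [set` J]) v n @^-1` A n) t)%:E = _).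
  apply: eq_integral => t _; congr (_%:E).
  rewrite [RHS]indicE.
  case: (boolP (t \in _)) => [/set_mem|/negP/[1!inE]] tA.
    rewrite big1// => n _; rewrite indicE mem_set//.
    by apply: (tA n); rewrite /= JE.
  have [n [nJ tAn]] : exists n, n \in J /\ ~ A n (v n t).
    apply: contrapT => h; apply: tA => n nJ.
    by apply: contrapT => tAn; apply: h; exists n.
  have nN : (n < N)%N by rewrite -JE.
  by rewrite (bigD1 (Ordinal nN))//= indicE memNset// mul0r.
rewrite integral_indic ?setIT//.
apply: fin_bigcap_measurable => [|n _]; first exact: finite_fset.
exact: measurable_preimage_mfun.
Qed.

(** Induction on the number [m] of leading factors that may be arbitrary, the
    others being indicators: the other factors form a weight, which
    [ge0_integral_weight] moves from indicators to [f m]. *)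
Lemma independent_prod (f : nat -> E -> R) (N : nat) :
  (forall n, measurable_fun setT (f n)) -> (forall n y, 0 <= f n y)%R ->
  (forall n, \int[P]_t (f n (v n t))%:E \is a fin_num) ->
  \int[P]_t (\prod_(n < N) f n (v n t))%:E =
  \prod_(n < N) \int[P]_t (f n (v n t))%:E.
Proof.
(* the set of an indicator is recovered as the preimage of [1] *)
suff : forall m (f : nat -> E -> R),
    (forall n, measurable_fun setT (f n)) -> (forall n y, 0 <= f n y)%R ->
    (forall n, \int[P]_t (f n (v n t))%:E \is a fin_num) ->
    (forall n, (m <= n < N)%N -> f n = \1_(f n @^-1` [set 1%R])) ->
    \int[P]_t (\prod_(n < N) f n (v n t))%:E =
    \prod_(n < N) \int[P]_t (f n (v n t))%:E.
  move=> /(_ N) H mf f0 ffin; apply: H => // n /andP[Nn nN].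
  by move: (leq_ltn_trans Nn nN); rewrite ltnn.
have intI n (A : set E) : measurable A ->
    \int[P]_t (\1_A (v n t))%:E = P (v n @^-1` A).
  move=> mA; rewrite [LHS](_ : _ = \int[P]_t (\1_(v n @^-1` A) t)%:E)//.
  by rewrite integral_indic ?setIT//; exact: measurable_preimage_mfun.
elim=> [|m IHm] {}f mf f0 ffin find.
  have mA n : measurable (f n @^-1` [set 1%R]).
    by rewrite -[X in measurable X]setTI; exact: mf.
  transitivity (\int[P]_t (\prod_(n < N) \1_(f n @^-1` [set 1%R]) (v n t))%:E).
    apply: eq_integral => t _; congr (_%:E); apply: eq_bigr => n _.
    by rewrite {1}find//= ltn_ord.
  rewrite (independent_prod_indic (fun n => f n @^-1` [set 1%R]))//.
  apply: eq_bigr => n _; rewrite -intI//.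
  by apply: eq_integral => t _; rewrite [in RHS]find//= ltn_ord.
have [Nm|mN] := leqP N m.
  apply: IHm => // n /andP[mn nN].
  by move: (leq_ltn_trans mn (leq_trans nN Nm)); rewrite ltnn.
pose om := Ordinal mN; rewrite (bigD1 om)//=.
pose G t := (\prod_(n < N | n != om) f n (v n t))%R.
have -> : \int[P]_t (\prod_(n < N) f n (v n t))%:E =
    \int[P]_t (G t * f m (v m t))%:E.
  by apply: eq_integral => t _; rewrite (bigD1 om)//= mulrC.
rewrite muleC; apply: ge0_integral_weight => //.
- rewrite /G; under eq_fun do rewrite big_mkcond.
  apply: measurable_prod => n _; case: (n != om) => //; exact: measurableT_comp.
- by move=> t; apply: prodr_ge0.
- rewrite (eq_bigr (fun n : 'I_N => (fine (\int[P]_t (f n (v n t))%:E))%:E)).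
    by rewrite prodEFin.
  by move=> n _; rewrite fineK.
move=> A mA; pose f' n := if n == m then \1_A else f n : E -> R.
have f'E n : n != om -> f' n = f n by rewrite /f' -val_eqE /= => /negbTE ->.
have f'm : f' m = \1_A by rewrite /f' eqxx.
transitivity (\int[P]_t (\prod_(n < N) f' n (v n t))%:E).
  apply: eq_integral => t _; rewrite (bigD1 om)//= f'm mulrC; congr (_ * _)%:E.
  by apply: eq_bigr => n nm; rewrite f'E.
rewrite IHm.
- rewrite (bigD1 om)//= muleC; congr (_ * _); last first.
    by rewrite -intI//; apply: eq_integral => t _; rewrite f'm.
  by apply: eq_bigr => n nm; apply: eq_integral => t _; rewrite f'E.
- by move=> n; rewrite /f'; case: ifP => // _; exact: measurable_indic.
- by move=> n y; rewrite /f'; case: ifP.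
- move=> n; rewrite /f'; case: eqP => [->|_]; last exact: ffin.
  by rewrite intI// fin_num_measure//; exact: measurable_preimage_mfun.
move=> n /andP[mn nN]; rewrite /f'; case: eqVneq => [_|nm].
  congr (\1_ _); apply/seteqP; split=> y /=; rewrite indicE.
    by move=> yA; rewrite mem_set.
  by case: (boolP (y \in A)) => [/set_mem//|_] /eqP; rewrite eq_sym oner_eq0.
by apply: find; rewrite nN ltn_neqAle eq_sym nm mn.
Qed.

End independence.

(** * Exponential moments *)

(** From [exp (- x / 2) >= 1 - x / 2], squaring gives
    [exp x <= (1 - x / 2)^{-2}], and the coefficient [2] of [x^2] is the least
    for which the polynomial dominates this fraction up to [x = 1]. *)
Lemma expR_le_quadratic (R : realType) (x : R) :
  x <= 1 -> expR x <= 1 + x + 2 * x ^+ 2.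
Proof.
move=> x1.
have y0 : 0 < 1 - x / 2 by lra.
have exp_half : expR x * expR (- (x / 2)) ^+ 2 = 1.
  by rewrite expr2 -!expRD -[RHS]expR0; congr expR; field.
rewrite -(@ler_pM2r _ ((1 - x / 2) ^+ 2)) ?exprn_gt0//.
apply: (@le_trans _ _ 1).
  rewrite -[leRHS]exp_half ler_wpM2l ?expR_ge0// ler_sqr ?nnegrE ?expR_ge0//; last lra.
  by have := expR_ge1Dx (- (x / 2)).
rewrite -subr_ge0.
have -> : (1 + x + 2 * x ^+ 2) * (1 - x / 2) ^+ 2 - 1 =
    x ^+ 2 * ((1 - x) * (5 / 2 - x)) / 2 by field.
by rewrite divr_ge0// mulr_ge0 ?sqr_ge0// mulr_ge0; lra.
Qed.

(** A majorant of [exp (N^{-1/2} \sum_(n < N) wave k phi (x n))] whose mean over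
    independent uniform points factors into explicit integrals. *)
Definition exp_majorant {R : realType} {d : nat} (k : 'rV[int]_d) (phi : R)
    (N : nat) (x : nat -> d.-tuple R) : R :=
  \prod_(n < N) (1 + 2 / N%:R + (Num.sqrt N%:R)^-1 * wave k phi (x n)).

Lemma norm_wave_le1 (R : realType) (d : nat) (k : 'rV[int]_d) (phi : R)
  (x : d.-tuple R) : `|wave k phi x| <= 1.
Proof. exact: cos_max. Qed.

Lemma expR_le_factor (R : realType) (d : nat) (k : 'rV[int]_d) (phi : R)
    (N : nat) (x : d.-tuple R) : (0 < N)%N ->
  expR ((Num.sqrt N%:R)^-1 * wave k phi x) <=
  1 + 2 / N%:R + (Num.sqrt N%:R)^-1 * wave k phi x.
Proof.
move=> N0; have sN1 : 1 <= Num.sqrt N%:R :> R by rewrite -[X in X <= _]sqrtr1 ler_wsqrtr// ler1n.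
set s := Num.sqrt N%:R in sN1 *; set y := wave k phi x.
have ssq : s ^+ 2 = N%:R by rewrite sqr_sqrtr.
have /ler_normlP[_ y1] : `|y| <= 1 := norm_wave_le1 _ _ _ _ _.
have sV1 : s^-1 <= 1 by rewrite invf_le1//; lra.
have sV0 : 0 <= s^-1 by rewrite invr_ge0; lra.
apply: (le_trans (expR_le_quadratic _ _ _)).
  by rewrite (le_trans (ler_wpM2l sV0 y1))// mulr1.
rewrite [leRHS]addrAC lerD2l ler_wpM2l// exprMn exprVn ssq ler_piMr ?invr_ge0//.
by rewrite -real_normK ?num_real// expr_le1//; exact: norm_wave_le1.
Qed.

Lemma expR_le_majorant (R : realType) (d : nat) (k : 'rV[int]_d) (phi : R)
    (N : nat) (x : nat -> d.-tuple R) : (0 < N)%N ->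
  expR ((Num.sqrt N%:R)^-1 * \sum_(n < N) wave k phi (x n)) <=
  exp_majorant k phi N x.
Proof.
move=> N0; rewrite mulr_sumr expR_sum; apply: ler_prod => n _.
by rewrite expR_ge0 expR_le_factor.
Qed.

Section majorant_mean.
Context {R : realType} {disp : measure_display} {T : measurableType disp}
  {P : probability T R} {d : nat} {v : nat -> {RV P >-> d.-tuple R}}
  (v_indep : mutually_independent v)
  (v_unif : forall n : nat, uniform_on_cube (v n)).

Lemma measurable_exp_majorant (k : 'rV[int]_d) (phi : R) (N : nat) :
  measurable_fun setT (fun t => exp_majorant k phi N (fun n => v n t)).
Proof.
apply: measurable_prod => n _; apply: measurable_funD => //.
apply: measurable_funM => //.
exact: (measurableT_comp (measurable_wave _ _ _ _)).
Qed.

Lemma exp_majorant_mean (k : 'rV[int]_d) (phi : R) (N : nat) :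
  k != 0 -> (0 < N)%N ->
  (\int[P]_t (exp_majorant k phi N (fun n => v n t))%:E <= (expR 2)%:E)%E.
Proof.
move=> k0 N0; pose s : R := Num.sqrt N%:R.
pose f (n : nat) (x : d.-tuple R) := 1 + 2 / N%:R + s^-1 * wave k phi x.
have intf n : (\int[P]_t (f n (v n t))%:E = (1 + 2 / N%:R)%:E)%E.
  apply: (uniform_wave_mean (v_unif n)) => //.
  rewrite ger0_norm ?invr_ge0 ?sqrtr_ge0//.
  have sN1 : 1 <= s by rewrite -[X in X <= _]sqrtr1 ler_wsqrtr// ler1n.
  have : s^-1 <= 1 by rewrite invf_le1//; lra.
  have : 0 <= 2 / N%:R :> R by rewrite divr_ge0.
  lra.
rewrite (independent_prod v_indep f).
- rewrite (eq_bigr (fun=> (1 + 2 / N%:R)%:E))//.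
  rewrite prodEFin big_const_ord iter_mulr_1 lee_fin.
  have -> : expR 2 = expR (2 / N%:R) ^+ N :> R.
    by rewrite -expRM_natl; congr expR; field; rewrite pnatr_eq0 -lt0n.
  rewrite lerXn2r ?nnegrE ?expR_ge0 ?addr_ge0 ?divr_ge0//.
  exact: expR_ge1Dx.
- move=> n; apply: measurable_funD => //; apply: measurable_funM => //.
  exact: measurable_wave.
- by move=> n y; apply: le_trans (expR_le_factor _ _ _ _ _ _ N0); exact: expR_ge0.
- by move=> n; rewrite intf.
Qed.

End majorant_mean.

(** * Almost sure polynomial bounds *)

(** Polynomial growth along a sequence of nonnegative variables follows from
    bounded means: dividing by a factor growing quadratically makes the series
    of means, hence almost surely the series itself, converge. *)
Lemma ae_bounded_growth (R : realType) (disp : measure_display)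
    (T : measurableType disp) (mu : {measure set T -> \bar R})
    (f : nat -> T -> R) (M : nat -> R) :
  (forall l, measurable_fun setT (f l)) -> (forall l t, 0 <= f l t) ->
  (forall l, 0 < M l) -> (forall l, \int[mu]_t (f l t)%:E <= (M l)%:E)%E ->
  {ae mu, forall t, exists C : R, forall l, f l t <= C * (M l * (l.+1 * l.+2)%:R)}.
Proof.
move=> mf f0 M0 fM.
pose q l : R := M l * (l.+1 * l.+2)%:R.
have q0 l : 0 < q l by rewrite mulr_gt0// ltr0n.
pose g l t := ((q l)^-1 * f l t)%:E.
have g0 l t : (0 <= g l t)%E by rewrite lee_fin mulr_ge0 ?invr_ge0 ?(ltW (q0 l)).
have mg l : measurable_fun setT (g l).
  by apply/measurable_EFinP; exact: measurable_funM.
have intg l : (\int[mu]_t g l t <= ((l.+1%:R)^-1 - (l.+2%:R)^-1)%:E)%E.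
  rewrite /g; under eq_integral do rewrite EFinM.
  rewrite ge0_integralZl_EFin ?invr_ge0 ?(ltW (q0 l))//;
    [|by move=> t _; rewrite lee_fin|exact/measurable_EFinP].
    apply: (@le_trans _ _ ((q l)^-1%:E * (M l)%:E)%E).
    by apply: lee_wpmul2l; rewrite ?lee_fin ?invr_ge0 ?(ltW (q0 l)).
  rewrite -EFinM lee_fin /q natrM.
  have := M0 l; set m := M l => m0.
  rewrite le_eqVlt; apply/orP; left; apply/eqP.
  have l0 := ler0n R l; rewrite -[l.+2]addn2 -[l.+1]addn1 !natrD; field.
  by rewrite !gt_eqF//; lra.
(* the means of the terms are dominated by a telescoping series of sum [1] *)
have intS : (\int[mu]_t (\sum_(l <oo) g l t) <= 1%:E)%E.
  rewrite integral_nneseries//; apply: lime_le.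
    by apply: is_cvg_nneseries => l _ _; exact: integral_ge0.
  apply: nearW => n.
  apply: (@le_trans _ _ (\sum_(0 <= l < n) ((l.+1%:R)^-1 - (l.+2%:R)^-1)%:E)%E).
    by apply: lee_sum => l _; exact: intg.
  rewrite sumEFin lee_fin -[X in X <= _]opprK -sumrN.
  under eq_bigr do rewrite opprB.
  by rewrite (telescope_sumr (fun l => (l.+1%:R)^-1 : R))// invr1 opprB gerBl invr_ge0.
have mS : measurable_fun setT (fun t => \sum_(l <oo) g l t)%E.
  by apply: ge0_emeasurable_sum => // l t _ _.
have Sfin : mu.-integrable setT (fun t => \sum_(l <oo) g l t)%E.
  apply/integrableP; split=> //.
  apply: le_lt_trans (ltry 1); apply: le_trans intS.
  rewrite le_eqVlt; apply/orP; left; apply/eqP; apply: eq_integral => t _.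
  by rewrite gee0_abs// nneseries_ge0.
have := integrable_ae measurableT Sfin.
apply: filterS => t /(_ Logic.I) tfin; exists (fine (\sum_(l <oo) g l t)%E) => l.
rewrite -ler_pdivrMr; last exact: q0.
suff : (g l t <= \sum_(l <oo) g l t)%E.
  by rewrite -[X in (_ <= X)%E]fineK// lee_fin mulrC.
apply: (@le_trans _ _ (\sum_(0 <= j < l.+1) g j t)%E); last first.
  exact: nneseries_lim_ge.
by rewrite big_nat_recr//= leeDr// sume_ge0.
Qed.

Definition box_freq (d L : nat) (g : {ffun 'I_d -> 'I_L.*2.+1}) : 'rV[int]_d :=
  \row_i ((g i)%:Z - L%:Z).
Arguments box_freq {d L}.

Lemma box_freq_surj (d L : nat) (k : 'rV[int]_d) :
  (forall i, (`|k ord0 i| <= L)%N) ->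
  exists g : {ffun 'I_d -> 'I_L.*2.+1}, box_freq g = k.
Proof.
move=> kL; exists [ffun i => inord (absz (k ord0 i + L%:Z))].
apply/rowP => i; have := kL i; rewrite mxE ffunE [ord0]ord1 => kiL.
by rewrite inordK; lia.
Qed.

Section ae_majorant.
Context {R : realType} {disp : measure_display} {T : measurableType disp}
  {P : probability T R} {d : nat} {v : nat -> {RV P >-> d.-tuple R}}
  (v_indep : mutually_independent v)
  (v_unif : forall n : nat, uniform_on_cube (v n)).

(** Each of the [(2 L + 1)^d * L * 4] majorants in range has mean at most [e^2],
    so [ae_bounded_growth] bounds their sum by a multiple of
    [(2 L + 1)^d * L * (L * (L + 1))], of degree [d + 3]. *)
Lemma ae_exp_majorant_polynomial : {ae P, forall t, exists C : R,
  forall (L N q : nat) (k : 'rV[int]_d),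
    k != 0 -> (forall i, (`|k ord0 i| <= L)%N) -> (0 < N <= L)%N -> (q < 4)%N ->
    exp_majorant k (q%:R * (pi / 2)) N (fun n => v n t) <=
      C * (3 * L)%:R ^+ (d + 3)}.
Proof.
(* the index [l] stands for the range [L = l.+1], and the second component of an
   element of [I l] for the length [N] minus one *)
pose I l := ({ffun 'I_d -> 'I_l.+1.*2.+1} * 'I_l.+1 * 'I_4)%type.
pose W l (i : I l) t : R := if box_freq i.1.1 != 0 then
  exp_majorant (box_freq i.1.1) (i.2%:R * (pi / 2)) i.1.2.+1 (fun n => v n t)
  else 0.
have mW l i : measurable_fun setT (W l i).
  by rewrite /W; case: (box_freq _ != 0) => //; exact: measurable_exp_majorant.
have W0 l i t : 0 <= W l i t.
  rewrite /W; case: ifP => // _; apply: (le_trans (expR_ge0 _)).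
  exact: expR_le_majorant.
have intW l i : (\int[P]_t (W l i t)%:E <= (expR 2)%:E)%E.
  rewrite /W; case: eqVneq => [_|k0]; last exact: exp_majorant_mean.
  by rewrite /= integral0 lee_fin expR_ge0.
have cardI l : #|{: I l}| = (l.+1.*2.+1 ^ d * l.+1 * 4)%N.
  by rewrite !card_prod card_ffun !card_ord.
have := @ae_bounded_growth R disp T P (fun l t => \sum_(i : I l) W l i t)
  (fun l => expR 2 * #|{: I l}|%:R).
have mS l : measurable_fun setT (fun t => \sum_(i : I l) W l i t).
  exact: measurable_sum.
have S0 l t : 0 <= \sum_(i : I l) W l i t by exact: sumr_ge0.
move=> /(_ mS S0) growth.
have {growth} : {ae P, forall t, exists C : R, forall l,
    \sum_(i : I l) W l i t <= C * (expR 2 * #|{: I l}|%:R * (l.+1 * l.+2)%:R)}.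
  apply: growth => [l|l].
    by rewrite mulr_gt0 ?expR_gt0// ltr0n cardI !muln_gt0 expn_gt0.
  under eq_integral do rewrite -sumEFin.
  rewrite ge0_integral_sum//;
    [|by move=> i; exact/measurable_EFinP|by move=> i t _; rewrite lee_fin].
  apply: (@le_trans _ _ (\sum_(i : I l) (expR 2)%:E)%E).
    by apply: lee_sum => i _; exact: intW.
  by rewrite sumEFin lee_fin sumr_const mulr_natr.
apply: filterS => t [C growth].
have C0 : 0 <= C.
  have := le_trans (S0 0%N t) (growth 0%N); rewrite pmulr_lge0//.
  by rewrite !mulr_gt0 ?expR_gt0// ltr0n cardI !muln_gt0 expn_gt0.
exists (C * (expR 2 * 4)) => L N q k k0 kL /andP[N0 NL] q4.
case: L kL NL => [|l] kL NL; first by rewrite leqn0 in NL; rewrite (eqP NL) in N0.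
have [g gk] := box_freq_surj _ _ _ kL.
have Nl : (N.-1 < l.+1)%N by rewrite prednK.
pose i : I l := (g, Ordinal Nl, Ordinal q4).
have -> : exp_majorant k (q%:R * (pi / 2)) N (fun n => v n t) = W l i t.
  by rewrite /W /= gk k0 prednK.
apply: (@le_trans _ _ (\sum_(i : I l) W l i t)).
  by rewrite (bigD1 i)//= lerDl sumr_ge0.
apply: (le_trans (growth l)).
rewrite -[leRHS]mulrA ler_wpM2l// -[leLHS]mulrA -[leRHS]mulrA ler_wpM2l ?expR_ge0//.
rewrite -natrX -!natrM ler_nat cardI expnD.
have -> : (l.+1.*2.+1 ^ d * l.+1 * 4 * (l.+1 * l.+2) =
   4 * (l.+1.*2.+1 ^ d * (l.+1 * (l.+1 * l.+2))))%N by lia.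
rewrite leq_mul2l /= leq_mul//.
  by case: (d) => // e; rewrite leq_exp2r//; lia.
rewrite !expnS expn0 muln1; apply: leq_mul; first by lia.
by apply: leq_mul; lia.
Qed.

End ae_majorant.

(** * From exponential majorants to uniform distribution *)

Lemma normc_le_sum (R : realType) (a b : R) :
  ComplexField.Normc.normc (Complex a b) <= `|a| + `|b|.
Proof.
rewrite /= -[leRHS]ger0_norm ?addr_ge0// -sqrtr_sqr ler_wsqrtr//.
rewrite sqrrD !real_normK ?num_real// -addrA lerD2l lerDr.
by rewrite mulrn_wge0// mulr_ge0.
Qed.

Lemma normc_exp_mean_le (R : realType) (d : nat) (x : nat -> d.-tuple R)
    (k : 'rV[int]_d) (N : nat) :
  ComplexField.Normc.normc (exp_mean x k N) <=
  N%:R^-1 * (`|\sum_(n < N) cos (2 * pi * dotprod k (x n))| +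
             `|\sum_(n < N) sin (2 * pi * dotprod k (x n))|).
Proof.
rewrite /exp_mean.
have -> : \sum_(n < N) expi (2 * pi * dotprod k (x n)) =
    Complex (\sum_(n < N) cos (2 * pi * dotprod k (x n)))
            (\sum_(n < N) sin (2 * pi * dotprod k (x n))).
  by elim: N => [|N IHN]; rewrite ?big_ord0// !big_ord_recr/= IHN.
have -> : N%:R^-1 = Complex N%:R^-1 0 :> R[i].
  by rewrite -[Complex _ _]/((N%:R^-1)%:C%C) fmorphV rmorph_nat.
rewrite ComplexField.Normc.normcM; apply: ler_pM => //; last exact: normc_le_sum.
- exact: sqrtr_ge0.
- exact: sqrtr_ge0.
- by rewrite /= expr0n/= addr0 sqrtr_sqr ger0_norm.
Qed.

(** The four quarter-turn phases produce both signs of the cosine and sine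
    sums, so that one-sided bounds on them control the exponential sum. *)
Lemma exp_mean_le_waves (R : realType) (d : nat) (x : nat -> d.-tuple R)
    (k : 'rV[int]_d) (N : nat) (B : R) :
  (forall q, (q < 4)%N -> \sum_(n < N) wave k (q%:R * (pi / 2)) (x n) <= B) ->
  ComplexField.Normc.normc (exp_mean x k N) <= N%:R^-1 * (2 * B).
Proof.
move=> waveB; apply: (le_trans (normc_exp_mean_le _ _ _ _ _)).
rewrite ler_wpM2l ?invr_ge0//.
have -> : 2 * B = B + B by ring.
have pi32 y : cos (y + 3%:R * (pi / 2)) = sin y :> R.
  have -> : y + 3%:R * (pi / 2) = y + pi / 2 + pi by field.
  by rewrite cosDpi cosDpihalf opprK.
apply: lerD; apply/ler_normlP; split; rewrite -?sumrN.
- apply: le_trans (waveB 2%N isT); apply: ler_sum => n _.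
  by rewrite /wave [2%:R * (pi / 2)]mulrC divfK// cosDpi.
- apply: le_trans (waveB 0%N isT); apply: ler_sum => n _.
  by rewrite /wave mul0r addr0.
- apply: le_trans (waveB 1%N isT); apply: ler_sum => n _.
  by rewrite /wave mul1r cosDpihalf.
- apply: le_trans (waveB 3%N isT); apply: ler_sum => n _.
  by rewrite /wave pi32.
Qed.

Lemma ln_le_powR (R : realType) (eta y : R) : 0 < eta -> 0 < y ->
  ln y <= eta^-1 * y `^ eta.
Proof.
move=> eta0 y0; rewrite ler_pdivlMl// -ln_powR.
by apply/ltW/ln_sublinear; exact: powR_gt0.
Qed.

(** An integral square of the norm, so that [N * sqnorm k] can serve as a natural
    bound on both the length and the coordinates of the frequency. *)
Definition sqnorm (d : nat) (k : 'rV[int]_d) : nat :=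
  (\sum_(i < d) `|k ord0 i| ^ 2)%N.
Arguments sqnorm {d}.

Lemma enormE (R : realType) (d : nat) (k : 'rV[int]_d) :
  enorm R d k = Num.sqrt (sqnorm k)%:R.
Proof.
rewrite /enorm /sqnorm natr_sum; congr Num.sqrt; apply: eq_bigr => i _.
by rewrite natrX natr_absz intr_norm real_normK ?num_real.
Qed.

Lemma sqnorm_coord (d : nat) (k : 'rV[int]_d) (i : 'I_d) :
  (`|k ord0 i| <= sqnorm k)%N.
Proof.
rewrite /sqnorm (bigD1 i)//=; apply: leq_trans (leq_addr _ _).
by case: `|k ord0 i|%N => // n; rewrite -mulnn leq_pmulr.
Qed.

Lemma sqnorm_gt0 (d : nat) (k : 'rV[int]_d) : k != 0 -> (0 < sqnorm k)%N.
Proof.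
apply: contra_neqT; rewrite -leqNgt leqn0 => /eqP k0.
apply/rowP => i; rewrite mxE; apply/eqP; rewrite -absz_eq0 -leqn0.
by have := sqnorm_coord _ k i; rewrite k0 [ord0]ord1.
Qed.

(** Subgaussian sums of size [sqrt N (log C + (d + 3) log (3 N |k|^2))] beat
    [|k|^eps N^(1 - gamma)], because logarithms grow more slowly than any
    positive power. *)
Lemma gamma_uniformly_distributed_of_majorant (R : realType) (d : nat)
    (x : nat -> d.-tuple R) (C gamma : R) :
  (forall n, unit_cube R d (x n)) -> gamma < 1 / 2 ->
  (forall (L N q : nat) (k : 'rV[int]_d),
    k != 0 -> (forall i, (`|k ord0 i| <= L)%N) -> (0 < N <= L)%N -> (q < 4)%N ->
    exp_majorant k (q%:R * (pi / 2)) N x <= C * (3 * L)%:R ^+ (d + 3)) ->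
  gamma_uniformly_distributed gamma x.
Proof.
move=> xcube gamma_lt bound; split=> // eps eps0.
pose delta := 1 / 2 - gamma.
have delta0 : 0 < delta by rewrite subr_gt0.
(* [L^eta <= |k|^eps N^delta] for [L = N |k|^2], as both bases are at least 1 *)
pose eta := Num.min delta (eps / 2).
have eta0 : 0 < eta by rewrite lt_min delta0 divr_gt0.
pose C1 := Num.max C 1.
have C1_ge1 : 1 <= C1 by rewrite le_max lexx orbT.
pose D := ln C1 + (d + 3)%:R * (ln 3 + eta^-1).
exists (2 * D) => k N k0 N0.
have N1 : 1 <= N%:R :> R by rewrite ler1n.
have K0 := sqnorm_gt0 _ _ k0.
have K1 : 1 <= (sqnorm k)%:R :> R by rewrite ler1n.
pose e := enorm R d k.
have e1 : 1 <= e.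
  by rewrite /e enormE -[X in X <= _]sqrtr1 ler_wsqrtr.
have eK : (sqnorm k)%:R = e ^+ 2 by rewrite /e enormE sqr_sqrtr.
pose s : R := Num.sqrt N%:R.
have s0 : 0 < s by rewrite sqrtr_gt0; lra.
pose L := (N * sqnorm k)%N.
have L0 : 0 < L%:R :> R by rewrite ltr0n muln_gt0 N0.
have pow_ge1 : 1 <= e `^ eps * N%:R `^ delta.
  have powR_ge1 a r : 1 <= a -> 0 < r -> 1 <= a `^ r :> R.
    by move=> a1 r0; rewrite -(powRr0 a) ler_powR// ltW.
  by rewrite mulr_ege1 ?powR_ge1.
have Lpow : L%:R `^ eta <= e `^ eps * N%:R `^ delta.
  rewrite /L natrM eK powRM ?sqr_ge0// mulrC -powR_mulrn; last lra.
  rewrite -powRrM; apply: ler_pM; rewrite ?powR_ge0//; apply: ler_powR => //.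
    have : eta <= eps / 2 by rewrite ge_min lexx orbT.
    by lra.
  by rewrite ge_min lexx.
have waveB q : (q < 4)%N ->
    \sum_(n < N) wave k (q%:R * (pi / 2)) (x n) <= s * (D * (e `^ eps * N%:R `^ delta)).
  move=> q4; rewrite -ler_pdivrMl//.
  have L30 : 0 < (3 * L)%:R :> R by rewrite natrM mulr_gt0.
  have {}bound : expR (s^-1 * \sum_(n < N) wave k (q%:R * (pi / 2)) (x n)) <=
      C1 * (3 * L)%:R ^+ (d + 3).
    apply: le_trans (expR_le_majorant _ _ _ _ _ _ N0) _.
    apply: le_trans (bound L N q k k0 _ _ q4) _.
    - by move=> i; apply: leq_trans (sqnorm_coord _ _ _) (leq_pmull _ N0).
    - by rewrite N0 leq_pmulr.
    by rewrite ler_wpM2r ?exprn_ge0 ?(ltW L30)// le_max lexx.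
  rewrite -[leLHS]expRK.
  apply: (@le_trans _ _ (ln (C1 * (3 * L)%:R ^+ (d + 3)))).
    rewrite ler_ln ?posrE ?expR_gt0// mulr_gt0 ?exprn_gt0//; lra.
  rewrite lnM ?posrE ?exprn_gt0//; last lra.
  rewrite lnXn// natrM lnM ?posrE// -[(_ + _) *+ _]mulr_natl.
  rewrite /D mulrDl; apply: lerD.
    by rewrite ler_peMr// ln_ge0.
  rewrite -mulrA ler_wpM2l// mulrDl; apply: lerD.
    by rewrite ler_peMr// ln_ge0// ler1n.
  apply: (le_trans (ln_le_powR _ _ _ eta0 L0)).
  by rewrite ler_wpM2l// invr_ge0 ltW.
apply: (le_trans (exp_mean_le_waves _ _ _ _ _ _ waveB)).
rewrite le_eqVlt; apply/orP; left; apply/eqP.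
have -> : N%:R `^ (- gamma) = N%:R^-1 * s * N%:R `^ delta.
  have Nn0 : N%:R != 0 :> R by rewrite pnatr_eq0 -lt0n.
  rewrite /s -powR12_sqrt// -powR_inv1// -!powRD ?Nn0 ?implybT//.
  by congr (_ `^ _); rewrite /delta; field.
by rewrite /e; ring.
Qed.

Theorem proposition2p1 (R : realType) (disp : measure_display)
    (T : measurableType disp) (P : probability T R) (d : nat) (d_ge1 : (1 <= d)%N)
    (v : nat -> {RV P >-> d.-tuple R})
    (v_indep : mutually_independent v)
    (v_unif : forall n : nat, uniform_on_cube (v n)) :
  {ae P, forall omega : T,
     forall gamma : R, 0 < gamma -> gamma < 1 / 2 ->
       gamma_uniformly_distributed gamma (fun n : nat => v n omega)}.
Proof.
have cube : {ae P, forall omega, forall n, unit_cube R d (v n omega)}.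
  by apply: ae_foralln => n; exact: uniform_in_unit_cube (v_unif n).
have := ae_exp_majorant_polynomial v_indep v_unif.
apply: filterS2 cube => omega omega_cube [C majorant] gamma _ gamma_lt.
exact: gamma_uniformly_distributed_of_majorant majorant.
Qed.
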